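(* Let $0<\mu<L<\infty$, let $\bar x, x_1^\star,\dots,x_m^\star\in\mathbb{R}^n$ satisfy $\|x_i^\star-\bar x\|\leq 1$ for all $i\in[m]$, and let $f_i\in\mathcal{M}_{\mu, L}(x_i^\star)$ for $i\in [m]$. If $x^\star\in\operatorname{argmin}_{x\in\mathbb{R}^n} \sum_{i=1}^m f_i(x)$, then $$\|x^\star-\bar x\|\leq \frac{1}{2}\left(\sqrt{\kappa}+\frac{1}{\sqrt{\kappa}}\right), \quad \text{where } \kappa=\frac{L}{\mu}.$$
   Context: $[m]=\{1,\dots,m\}$. $\|\cdot\|$ and $\langle\cdot,\cdot\rangle$ are the Euclidean norm and dot product on $\mathbb{R}^n$. For a convex $f:\mathbb{R}^n\to(-\infty,\infty]$ and $x\in\mathrm{dom}\, f$, $\partial f(x)=\{g: f(y)\ge f(x)+\langle g,y-x\rangle\ \forall y\in\mathbb{R}^n\}$. A convex function $f$ is $L$-smooth ($0<L<\infty$) if $\|g_1-g_2\|\le L\|x_1-x_2\|$ for all $x_1,x_2\in\mathbb{R}^n$, $g_1\in\partial f(x_1)$, $g_2\in\partial f(x_2)$; this means $f$ is differentiable on $\mathbb{R}^n$ with $L$-Lipschitz gradient. $f$ is $\mu$-strongly convex if $x\mapsto f(x)-\frac{\mu}{2}\|x\|^2$ is convex. $\mathcal{F}_{\mu,L}(\mathbb{R}^n)$ is the set of closed proper convex functions that are $L$-smooth and $\mu$-strongly convex, and $\mathcal{M}_{\mu,L}(z)$ is the set of functions in $\mathcal{F}_{\mu,L}(\mathbb{R}^n)$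 for which $z$ is a (global) minimizer. *)

(* Defs.v *)
From mathcomp Require Import all_boot all_order all_algebra.
From mathcomp Require Import all_classical all_reals all_analysis.
Set Implicit Arguments.
Unset Strict Implicit.
Unset Printing Implicit Defensive.
Import Order.TTheory GRing.Theory Num.Theory.
Import numFieldNormedType.Exports.
Local Open Scope classical_set_scope.
Local Open Scope ring_scope.

Definition dotp (R : realType) (n : nat) (u v : 'rV[R]_n) : R :=
  \sum_(k < n) u 0 k * v 0 k.

(* The library's norm `|x| on row vectors is the sup norm, hence this one.
   The two norms induce the same topology. *)
Definition enorm (R : realType) (n : nat) (u : 'rV[R]_n) : R :=
  Num.sqrt (dotp u u).

Definition edom (R : realType) (n : nat) (f : 'rV[R]_n -> \bar R) :
    set 'rV[R]_n :=
  [set x | (f x < +oo)%E].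

Definition proper (R : realType) (n : nat) (f : 'rV[R]_n -> \bar R) : Prop :=
  (forall x, f x != -oo%E) /\ edom f !=set0.

Definition epigraph (R : realType) (n : nat) (f : 'rV[R]_n -> \bar R) :
    set ('rV[R]_n * R) :=
  [set p | (f p.1 <= p.2%:E)%E].

Definition closed_fun (R : realType) (n : nat) (f : 'rV[R]_n -> \bar R) :
    Prop :=
  closed (epigraph f).

(* Meant for functions that avoid -oo, so that no indeterminate sum occurs on
   the right-hand side; 0 * +oo = 0 makes the cases t = 0 and t = 1 trivial. *)
Definition convex_fun (R : realType) (n : nat) (f : 'rV[R]_n -> \bar R) :
    Prop :=
  forall (x y : 'rV[R]_n) (t : R), 0 <= t <= 1 ->
    (f (t *: x + (1 - t) *: y)%R <= t%:E * f x + (1 - t)%:E * f y)%E.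

Definition subdiff (R : realType) (n : nat) (f : 'rV[R]_n -> \bar R)
    (x : 'rV[R]_n) : set 'rV[R]_n :=
  [set g | edom f x /\
           forall y, (f x + (dotp g (y - x)%R)%:E <= f y)%E].

Definition smooth_fun (R : realType) (n : nat) (L : R)
    (f : 'rV[R]_n -> \bar R) : Prop :=
  forall x1 x2 g1 g2 : 'rV[R]_n, subdiff f x1 g1 -> subdiff f x2 g2 ->
    enorm (g1 - g2) <= L * enorm (x1 - x2).

Definition strongly_convex (R : realType) (n : nat) (mu : R)
    (f : 'rV[R]_n -> \bar R) : Prop :=
  convex_fun (fun x => (f x - (mu / 2 * enorm x ^+ 2)%:E)%E).

Definition argmin (R : realType) (n : nat) (f : 'rV[R]_n -> \bar R) :
    set 'rV[R]_n :=
  [set z | forall y, (f z <= f y)%E].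

Definition classF (R : realType) (n : nat) (mu L : R) :
    set ('rV[R]_n -> \bar R) :=
  [set f | [/\ closed_fun f, proper f, convex_fun f,
               smooth_fun L f & strongly_convex mu f]].

Definition classM (R : realType) (n : nat) (mu L : R) (z : 'rV[R]_n) :
    set ('rV[R]_n -> \bar R) :=
  [set f | classF mu L f /\ argmin f z].

(* Main.v *)
Require Import Defs.
From mathcomp Require Import all_boot all_order all_algebra.
From mathcomp Require Import all_classical all_reals all_analysis.
From mathcomp Require Import ring lra.
Import Order.TTheory GRing.Theory Num.Theory.
Import numFieldNormedType.Exports.
Local Open Scope classical_set_scope.
Local Open Scope ring_scope.

(** Why the bound holds.  Write e = x* - xbar, u_i = x_i* - xbar, and let g_i
    be the gradient of f_i at x*, so that sum_i g_i = 0.  Since f_i is L-smooth,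
    mu-strongly convex and minimal at x_i*, the pair (e - u_i, g_i) satisfies
      < g_i - mu (e - u_i), L (e - u_i) - g_i > >= 0          (interpolation).
    With s = (L + mu) / 2 and p = mu L, adding s^2 times this inequality to
      | s g_i + s^2 u_i - p e |^2 >= 0
    makes the products <g_i, u_i> and <u_i, e> disappear; what remains, after
    division by s^2 - p = ((L - mu) / 2)^2 > 0, is
      p |e|^2 <= s^2 |u_i|^2 + 2 s <g_i, e>                (pointwise_bound).
    Summing over i kills the last term and gives |e|^2 <= s^2 / p, which is the
    square of (sqrt kappa + 1 / sqrt kappa) / 2.

    The functions are extended-valued, and smoothness only constrains the
    subgradients that exist, so it has to be shown that every point has one
    (subdiff_nonempty); finiteness on the whole space follows.  Let z be the
    minimizer of f.  The minimizer p_k of f + w_k | . - x |^2 with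
    w_k = L (k + 1) exists because minimizing sequences are Cauchy by strong
    convexity (prox_attained), and g_k = 2 w_k (x - p_k) is a subgradient at
    p_k.  Comparing g_k with the subgradient 0 at z through smoothness bounds
    | x - p_k |, so that p_k tends to x; smoothness again makes (g_k) Cauchy,
    and its limit is a subgradient at x because the epigraph is closed.

    Once f is real-valued with an L-Lipschitz selection of subgradients, the
    descent inequality comes from Riemann sums along a segment, and the
    quadratic lower bound from strong convexity; the interpolation inequality
    and the optimality condition sum_i g_i = 0 (stationary) follow from these
    two bounds alone. *)

(** * Euclidean geometry of row vectors *)

Section EuclideanSpace.
Set Implicit Arguments.
Unset Strict Implicit.
Context {R : realType} {n : nat}.
Implicit Types (u v w : 'rV[R]_n) (a b : R).

Lemma dotpC u v : dotp u v = dotp v u.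
Proof. by apply: eq_bigr => k _; rewrite mulrC. Qed.

Lemma dotpDl u v w : dotp (u + v) w = dotp u w + dotp v w.
Proof. by rewrite -big_split; apply: eq_bigr => k _; rewrite mxE mulrDl. Qed.

Lemma dotpZl a u v : dotp (a *: u) v = a * dotp u v.
Proof. by rewrite mulr_sumr; apply: eq_bigr => k _; rewrite mxE mulrA. Qed.

Lemma dotpNl u v : dotp (- u) v = - dotp u v.
Proof. by rewrite -scaleN1r dotpZl mulN1r. Qed.

Lemma dotpDr u v w : dotp u (v + w) = dotp u v + dotp u w.
Proof. by rewrite dotpC dotpDl !(dotpC u). Qed.

Lemma dotpZr a u v : dotp u (a *: v) = a * dotp u v.
Proof. by rewrite dotpC dotpZl dotpC. Qed.

Lemma dotpNr u v : dotp u (- v) = - dotp u v.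
Proof. by rewrite dotpC dotpNl dotpC. Qed.

Lemma dotp0l u : dotp 0 u = 0.
Proof. by rewrite -(scale0r 0) dotpZl mul0r. Qed.

Definition dotpE := (dotpDl, dotpDr, dotpZl, dotpZr, dotpNl, dotpNr).

Lemma dotp_subC u v : dotp (u - v) (u - v) = dotp (v - u) (v - u).
Proof. by rewrite -(opprB v u) dotpNl dotpNr opprK. Qed.

Lemma dotp_suml m (u : 'I_m -> 'rV[R]_n) v :
  dotp (\sum_i u i) v = \sum_i dotp (u i) v.
Proof.
by apply: (big_morph (fun w => dotp w v)) => [w w'|];
  [exact: dotpDl | exact: dotp0l].
Qed.

Lemma dotp_ge0 u : 0 <= dotp u u.
Proof. by apply: sumr_ge0 => k _; rewrite -expr2 sqr_ge0. Qed.

Lemma enorm_sqr u : enorm u ^+ 2 = dotp u u.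
Proof. by rewrite sqr_sqrtr // dotp_ge0. Qed.

(** The norm [`|u|] is the largest coordinate in absolute value; this comparison
    transfers Euclidean estimates to the topology of row vectors. *)
Lemma norm_sqr_le_dotp u : `|u| ^+ 2 <= dotp u u.
Proof.
have [->|] := eqVneq `|u| 0; first by rewrite expr0n dotp_ge0.
change `|u| with (mx_norm u) => /mx_norm_neq0[[i j] ->] /=.
rewrite (ord1 i) real_normK ?num_real// /dotp (bigD1 j)//= -expr2 lerDl.
by apply: sumr_ge0 => k _; rewrite -expr2 sqr_ge0.
Qed.

Lemma dotp_eq0 u : dotp u u <= 0 -> u = 0.
Proof.
move=> u0; apply: normr0_eq0; apply/eqP; rewrite -sqrf_eq0 eq_le sqr_ge0.
by rewrite (le_trans (norm_sqr_le_dotp u)).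
Qed.

(** The form of the Cauchy-Schwarz inequality needed for Lipschitz maps, obtained
    without square roots by expanding the square of a v - u. *)
Lemma dotp_le_of_sqr u v a : 0 < a ->
  dotp u u <= a ^+ 2 * dotp v v -> dotp u v <= a * dotp v v.
Proof.
move=> a0 uv; have := dotp_ge0 (a *: v - u).
rewrite !dotpE (dotpC v u) => H.
rewrite -(ler_pM2l a0); nra.
Qed.

(** Expanding the square of u + v - 2 w; stands in for the triangle inequality
    on squared norms. *)
Lemma dotp_subr_le u v w :
  dotp (u - v) (u - v) <= 2 * (dotp (u - w) (u - w) + dotp (v - w) (v - w)).
Proof.
have := dotp_ge0 (u + v - 2 *: w); rewrite !dotpE.
rewrite (dotpC v u) (dotpC w u) (dotpC w v); lra.
Qed.

Lemma cvg_dotp {u_ v_ : nat -> 'rV[R]_n} {u v} :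
  u_ k @[k --> \oo] --> u -> v_ k @[k --> \oo] --> v ->
  dotp (u_ k) (v_ k) @[k --> \oo] --> dotp u v.
Proof.
move=> uu vv; apply: cvg_big => [|j _]; [exact: add_continuous | apply: cvgM].
- exact: (cvg_comp _ _ uu (@coord_continuous R 1 n 0 j u)).
- exact: (cvg_comp _ _ vv (@coord_continuous R 1 n 0 j v)).
Qed.

Lemma cvg_of_dotp {u_ : nat -> 'rV[R]_n} {u} C :
  (forall k, dotp (u - u_ k) (u - u_ k) <= C * k.+1%:R^-1) ->
  u_ k @[k --> \oo] --> u.
Proof.
move=> uC; apply/cvgrPdist_le => e e0.
have Ck : C * harmonic k @[k --> \oo] --> C * (0 : R).
  by apply: cvgM; [exact: cvg_cst | exact: cvg_harmonic].
have : \forall k \near \oo, C * harmonic k < e ^+ 2.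
  apply: (cvgr_lt (C * 0)) => //; rewrite mulr0; exact: exprn_gt0.
apply: filterS => k /= Hk.
rewrite -(ler_pXn2r (ltn0Sn 1)) ?nnegrE ?normr_ge0 ?(ltW e0)//.
by apply: (le_trans (norm_sqr_le_dotp _)); apply: (le_trans (uC k)); exact: ltW.
Qed.

Lemma is_cvg_of_dotp (u_ : nat -> 'rV[R]_n) C :
  (forall j k, dotp (u_ j - u_ k) (u_ j - u_ k)
     <= C * (j.+1%:R^-1 + k.+1%:R^-1)) ->
  exists u, u_ k @[k --> \oo] --> u.
Proof.
move=> uC.
suff : cvg (u_ k @[k --> \oo]) by move=> ?; exists (lim (u_ k @[k --> \oo])).
apply/cauchy_cvgP/cauchy_ballP => e e0.
have Ck : C * harmonic k @[k --> \oo] --> C * (0 : R).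
  by apply: cvgM; [exact: cvg_cst | exact: cvg_harmonic].
have [N _ HN] : \forall k \near \oo, C * harmonic k < e ^+ 2 / 2.
  apply: (cvgr_lt (C * 0)) => //; rewrite mulr0 divr_gt0//; exact: exprn_gt0.
exists ([set u_ k | k in [set k | (N <= k)%N]],
        [set u_ k | k in [set k | (N <= k)%N]]) => /=.
  by split; exists N => // k /= Nk; exists k.
move=> [_ _] /= [[j Nj <-] [k Nk <-]].
rewrite -ball_normE /ball_ /=.
rewrite -(ltr_pXn2r (ltn0Sn 1)) ?nnegrE ?normr_ge0 ?(ltW e0)//.
apply: (le_lt_trans (norm_sqr_le_dotp _)); apply: (le_lt_trans (uC j k)).
by rewrite mulrDr [ltRHS]splitr; apply: ltrD; [exact: HN j Nj | exact: HN k Nk].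
Qed.

End EuclideanSpace.

(** * Existence of subgradients *)

(** Replaces dividing an inequality by a step size and letting the step size
    tend to 0. *)
Lemma le0_of_le_harmonic {R : realType} (a b : R) :
  (forall k, a <= harmonic k * b) -> a <= 0.
Proof.
move=> ab; rewrite leNgt; apply/negP => a0.
have b0 : 0 < `|b| + 1 by rewrite ltr_wpDl.
have [k] := ltr_add_invr (divr_gt0 a0 b0).
rewrite add0r ltr_pdivlMr// => lt; have := ab k; rewrite leNgt => /negP; apply.
apply: le_lt_trans lt; rewrite ler_pM2l ?invr_gt0//.
by apply: (le_trans (ler_norm b)); rewrite lerDl.
Qed.

Lemma harmonic_le1 {R : realType} k : harmonic k <= 1 :> R.
Proof. by rewrite /harmonic invf_le1 ?ler1n. Qed.

Section ExtendedConvex.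
Set Implicit Arguments.
Unset Strict Implicit.
Context {R : realType} {n : nat}.
Implicit Types (f : 'rV[R]_n -> \bar R) (x y z v g p : 'rV[R]_n) (r s : R).

Lemma convex_fun_le f x y r s (t : R) : convex_fun f -> 0 <= t <= 1 ->
  (f x <= r%:E)%E -> (f y <= s%:E)%E ->
  (f (t *: x + (1 - t) *: y)%R <= (t * r + (1 - t) * s)%R%:E)%E.
Proof.
move=> cf t01 xr ys; apply: (le_trans (cf x y t t01)).
have /andP[t0 t1] := t01.
by rewrite [leRHS]EFinD !EFinM; apply: leeD; apply: lee_wpmul2l;
  rewrite // lee_fin// subr_ge0.
Qed.

Lemma proper_fin f x : Defs.proper f -> edom f x -> exists r, f x = r%:E.
Proof.
move=> [fNoo _]; rewrite /edom/=; move: (fNoo x).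
by case: (f x) => [r||]//= _ _; exists r.
Qed.

Lemma proper_argmin_fin f z : Defs.proper f -> argmin f z -> exists r, f z = r%:E.
Proof.
move=> pf mz; apply: proper_fin => //.
by case: pf => _ [y fy]; exact: le_lt_trans (mz y) fy.
Qed.

(** Minimizing sequences of f + w | . - v |^2 are Cauchy: by the parallelogram
    identity the midpoint of two almost minimizers would otherwise have a value
    below the infimum.  Closedness of the epigraph shows that the infimum is attained
    at the limit.  Competitors are epigraph points (y, s), which avoids
    arithmetic on infinite values. *)
Lemma prox_attained f (c w : R) v :
  closed_fun f -> Defs.proper f -> convex_fun f ->
  (forall y, (c%:E <= f y)%E) -> 0 < w ->
  exists p r, f p = r%:E /\
    forall y s, (f y <= s%:E)%E ->
      r + w * dotp (p - v) (p - v) <= s + w * dotp (y - v) (y - v).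
Proof.
move=> cl pf cf fc w0.
pose S := [set q | exists y s, (f y <= s%:E)%E /\
                    q = s + w * dotp (y - v) (y - v)].
have Slb : lbound S c.
  move=> _ [y [s [ys ->]]]; have := le_trans (fc y) ys; rewrite lee_fin => cs.
  by apply: (le_trans cs); rewrite lerDl mulr_ge0 ?dotp_ge0// ltW.
have Sinf : has_inf S.
  split; last by exists c.
  have [_ [y fy]] := pf; have [s ys] := proper_fin pf fy.
  by exists (s + w * dotp (y - v) (y - v)), y, s; rewrite ys lexx.
pose q := inf S.
have qle y s : (f y <= s%:E)%E -> q <= s + w * dotp (y - v) (y - v).
  by move=> ys; apply: ge_inf; [exists c | exists y, s].
have /choice[u /choice[s_ us]] : forall k : nat, exists y s,
    (f y <= s%:E)%E /\ s + w * dotp (y - v) (y - v) < q + k.+1%:R^-1.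
  move=> k; have k0 : 0 < k.+1%:R^-1 :> R by rewrite invr_gt0.
  have [_ [y [s [ys ->]]] lt] := inf_adherent k0 Sinf.
  by exists y, s.
have [p up] : exists p, u k @[k --> \oo] --> p.
  apply: (is_cvg_of_dotp (C := 2 / w)) => j k.
  have [fj lj] := us j; have [fk lk] := us k.
  have h01 : 0 <= (2^-1 : R) <= 1 by apply/andP; split; lra.
  have := qle _ _ (convex_fun_le cf h01 fj fk).
  rewrite mulrAC ler_pdivlMr//.
  have -> : 2^-1 *: u j + (1 - 2^-1) *: u k - v
          = 2^-1 *: (u j - v) + 2^-1 *: (u k - v).
    by apply/rowP => i; rewrite !mxE; lra.
  have -> : u j - u k = (u j - v) - (u k - v) by rewrite opprB addrA subrK.
  move: (u j - v) (u k - v) lj lk => a b.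
  rewrite !dotpE (dotpC b a).
  move: (dotp a a) (dotp a b) (dotp b b) j.+1%:R^-1 k.+1%:R^-1.
  by clearbody q; clear h01; move=> A B D e1 e2; lra.
have fp : (f p <= (q - w * dotp (p - v) (p - v))%R%:E)%E.
  pose W k := (u k, q + harmonic k - w * dotp (u k - v) (u k - v)).
  suff Wcvg : W k @[k --> \oo] --> (p, q - w * dotp (p - v) (p - v)).
    apply: (closed_cvg (epigraph f) cl _ _ Wcvg); apply: nearW => k.
    rewrite /epigraph/=; have [fk lk] := us k.
    by apply: (le_trans fk); rewrite lee_fin lerBrDr ltW.
  have uv : u k - v @[k --> \oo] --> p - v by apply: cvgB => //; exact: cvg_cst.
  suff vcvg : q + harmonic k - w * dotp (u k - v) (u k - v) @[k --> \oo]
      --> q - w * dotp (p - v) (p - v) by exact: cvg_pair up vcvg.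
  rewrite -[X in _ --> X - _]addr0.
  apply: cvgB; first by apply: cvgD; [exact: cvg_cst | exact: cvg_harmonic].
  by apply: cvgM; [exact: cvg_cst | exact: cvg_dotp].
have [r fr] : exists r, f p = r%:E.
  by apply: proper_fin => //; apply: le_lt_trans fp _; exact: ltry.
exists p, r; split=> // y s ys; move: fp; rewrite fr lee_fin => rq.
by apply: (le_trans _ (qle _ _ ys)); rewrite -lerBrDr.
Qed.

(** First-order optimality of the proximal point p, from comparing p with
    p + t (y - p) and letting t tend to 0. *)
Lemma prox_subgradient f (c w : R) v :
  closed_fun f -> Defs.proper f -> convex_fun f ->
  (forall y, (c%:E <= f y)%E) -> 0 < w ->
  exists p, subdiff f p ((2 * w) *: (v - p)).
Proof.
move=> cl pf cf fc w0; have [p [r [fr min]]] := prox_attained v cl pf cf fc w0.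
exists p; split; first by rewrite /edom/= fr ltry.
move=> y; have [fNoo _] := pf; case fy: (f y) (fNoo y) => [s||]// _; last first.
  by rewrite leey.
rewrite fr -EFinD lee_fin -subr_le0.
apply: (@le0_of_le_harmonic _ _ (w * dotp (y - p) (y - p))) => k.
move: (@harmonic R k) (@harmonic_gt0 R k) (@harmonic_le1 R k) => t t0 t1.
have t01 : 0 <= t <= 1 by rewrite ltW.
have := min _ _ (convex_fun_le cf t01 (_ : (f y <= s%:E)%E) (_ : (f p <= r%:E)%E)).
rewrite fy fr !lexx => /(_ isT isT).
have -> : t *: y + (1 - t) *: p - v = (p - v) + t *: (y - p).
  by apply/rowP => i; rewrite !mxE; ring.
have -> : v - p = - (p - v) by rewrite opprB.
move: (p - v) (y - p) => a b.
rewrite !dotpE (dotpC b a) => H.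
rewrite -(ler_pM2l t0); nra.
Qed.

Lemma smooth_fun_sqr (L : R) f x1 x2 g1 g2 : 0 < L -> smooth_fun L f ->
  subdiff f x1 g1 -> subdiff f x2 g2 ->
  dotp (g1 - g2) (g1 - g2) <= L ^+ 2 * dotp (x1 - x2) (x1 - x2).
Proof.
move=> L0 sm s1 s2; rewrite -!enorm_sqr -exprMn.
by rewrite ler_pXn2r ?nnegrE ?mulr_ge0 ?sqrtr_ge0 ?(ltW L0)//; exact: sm s1 s2.
Qed.

Lemma subdiff_argmin f z : Defs.proper f -> argmin f z -> subdiff f z 0.
Proof.
move=> pf mz; have [r fz] := proper_argmin_fin pf mz.
by split=> [|y]; [rewrite /edom/= fz ltry | rewrite dotp0l adde0; exact: mz].
Qed.

(** Smoothness is a condition on existing subgradients only, but it forces a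
    closed function to have one at every point: proximal points of x with
    growing weights approach x, and their subgradients converge. *)
Lemma subdiff_nonempty (L : R) f z x : 0 < L ->
  closed_fun f -> Defs.proper f -> convex_fun f -> smooth_fun L f -> argmin f z ->
  exists g, subdiff f x g.
Proof.
move=> L0 cl pf cf sm mz; have [c fz] := proper_argmin_fin pf mz.
have fc y : (c%:E <= f y)%E by rewrite -fz; exact: mz.
have /choice[p sp] : forall k : nat, exists p,
    subdiff f p ((2 * (L * k.+1%:R)) *: (x - p)).
  by move=> k; apply: (prox_subgradient _ cl pf cf fc); rewrite mulr_gt0.
pose g k := (2 * (L * k.+1%:R)) *: (x - p k).
pose C := dotp (z - x) (z - x).
have pC k : dotp (x - p k) (x - p k) <= C * k.+1%:R^-1.
  rewrite ler_pdivlMr//.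
  have K1 : 1 <= k.+1%:R :> R by rewrite ler1n.
  have := smooth_fun_sqr L0 sm (sp k) (subdiff_argmin pf mz).
  have := dotp_subr_le (p k) z x.
  rewrite (dotp_subC (p k) x).
  rewrite subr0 dotpZl dotpZr -/C.
  have := dotp_ge0 (x - p k).
  move: (dotp (x - p k) (x - p k)) (dotp (p k - z) (p k - z)) => A B A0 BA AB.
  have {}AB : 4 * k.+1%:R ^+ 2 * A <= B.
    have L2 : 0 < L ^+ 2 by rewrite exprn_gt0.
    by rewrite -(ler_pM2l L2); lra.
  nra.
have pcvg : p k @[k --> \oo] --> x by exact: cvg_of_dotp pC.
have [g0 gcvg] : exists g0, g k @[k --> \oo] --> g0.
  apply: (is_cvg_of_dotp (C := L ^+ 2 * (2 * C))) => j k.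
  apply: (le_trans (smooth_fun_sqr L0 sm (sp j) (sp k))).
  rewrite -[leRHS]mulrA ler_pM2l ?exprn_gt0//.
  apply: (le_trans (dotp_subr_le _ _ x)).
  rewrite (dotp_subC (p j)) (dotp_subC (p k)).
  by rewrite -mulrA ler_pM2l// mulrDr lerD.
have key y s : (f y <= s%:E)%E -> (f x <= (s - dotp g0 (y - x))%R%:E)%E.
  move=> ys; pose W k := (p k, s - dotp (g k) (y - p k)).
  suff Wcvg : W k @[k --> \oo] --> (x, s - dotp g0 (y - x)).
    apply: (closed_cvg (epigraph f) cl _ _ Wcvg); apply: nearW => k.
    rewrite /epigraph/=; have [dp /(_ y)] := sp k.
    have [r ->] := proper_fin pf dp.
    by move=> /le_trans/(_ ys); rewrite -EFinD !lee_fin lerBrDr.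
  suff vcvg : s - dotp (g k) (y - p k) @[k --> \oo] --> s - dotp g0 (y - x).
    by exact: cvg_pair pcvg vcvg.
  apply: cvgB; first exact: cvg_cst.
  by apply: cvg_dotp => //; apply: cvgB => //; exact: cvg_cst.
have xdom : edom f x.
  by apply: le_lt_trans (key z c _) (ltry _); rewrite fz.
exists g0; split=> // y; have [r fx] := proper_fin pf xdom.
have [fNoo _] := pf; case fy: (f y) (fNoo y) => [s||]// _; last by rewrite leey.
have := key y s; rewrite fy lexx fx => /(_ isT).
by rewrite -EFinD !lee_fin lerBrDr.
Qed.

End ExtendedConvex.

(** * Quadratic bounds and interpolation *)

(** The graph of phi lies above all paraboloids of curvature c tangent to it
    with slope g x; for c = mu this is strong convexity. *)
Definition quadratic_minorants {R : realType} {n : nat} (c : R)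
    (phi : 'rV[R]_n -> R) (g : 'rV[R]_n -> 'rV[R]_n) : Prop :=
  forall x y, phi x + dotp (g x) (y - x) + c / 2 * dotp (y - x) (y - x)
              <= phi y.

(** The graph of phi lies below the same paraboloids; for c = L this is
    smoothness. *)
Definition quadratic_majorants {R : realType} {n : nat} (c : R)
    (phi : 'rV[R]_n -> R) (g : 'rV[R]_n -> 'rV[R]_n) : Prop :=
  forall x y, phi y <=
              phi x + dotp (g x) (y - x) + c / 2 * dotp (y - x) (y - x).

Section SmoothStronglyConvex.
Set Implicit Arguments.
Unset Strict Implicit.
Context {R : realType} {n : nat}.
Implicit Types (phi : 'rV[R]_n -> R) (g : 'rV[R]_n -> 'rV[R]_n)
  (x y : 'rV[R]_n) (mu L : R).

(** Moving from x to y in N equal steps h, each subgradient inequality is taken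
    at the end of its step and the Lipschitz bound compares that subgradient
    with g x.  The accumulated error is L / 2 (1 + 1 / N) | y - x |^2. *)
Lemma descent L phi g : 0 < L ->
  (forall x y : 'rV[R]_n, phi x + dotp (g x) (y - x) <= phi y) ->
  (forall x y : 'rV[R]_n, dotp (g x - g y) (g x - g y)
               <= L ^+ 2 * dotp (x - y) (x - y)) ->
  quadratic_majorants L phi g.
Proof.
move=> L0 sub lip x y.
have step (h : 'rV[R]_n) k : phi (x + k%:R *: h) <=
    phi x + k%:R * dotp (g x) h + L / 2 * (k%:R * (k%:R + 1)) * dotp h h.
  elim: k => [|k IH]; first by rewrite !scale0r addr0 !mul0r mulr0 mul0r !addr0.
  apply: (le_trans _ (_ : phi (x + k%:R *: h)
    + dotp (g x) h + L * k.+1%:R * dotp h h <= _)); last first.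
    by move: IH; rewrite -(natr1 k); lra.
  have := sub (x + k.+1%:R *: h) (x + k%:R *: h).
  have -> : x + k%:R *: h - (x + k.+1%:R *: h) = - h.
    by apply/rowP => i; rewrite !mxE -(natr1 k); ring.
  have k0 : 0 < k.+1%:R :> R by rewrite ltr0n.
  have Lk0 : 0 < L * k.+1%:R by rewrite mulr_gt0.
  have := @dotp_le_of_sqr _ _ (g (x + k.+1%:R *: h) - g x) h _ Lk0.
  have := lip (x + k.+1%:R *: h) x.
  have -> : x + k.+1%:R *: h - x = k.+1%:R *: h by rewrite addrC addKr.
  rewrite (dotpZl k.+1%:R) (dotpZr k.+1%:R) => {}lip /(_ _) H.
  have {}H : dotp (g (x + k.+1%:R *: h) - g x) h <= L * k.+1%:R * dotp h h.
    by apply: H; apply: (le_trans lip); rewrite exprMn; lra.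
  by move: H; rewrite dotpNr dotpDl dotpNl; lra.
rewrite -subr_le0.
apply: (@le0_of_le_harmonic _ _ (L / 2 * dotp (y - x) (y - x))) => k.
have := step (k.+1%:R^-1 *: (y - x)) k.+1.
rewrite scalerA mulfV// scale1r addrC subrK [leRHS]addrC.
rewrite !dotpZl !dotpZr /harmonic.
have k0 : 0 < k.+1%:R :> R by rewrite ltr0n.
move: (dotp (y - x) (y - x)) (dotp (g x) (y - x)) => D G /le_trans H.
rewrite lerBlDr; apply: H; rewrite /= le_eqVlt; apply/orP; left; apply/eqP.
by move: k.+1%:R k0 => K k0; field; rewrite gt_eqF.
Qed.

(** Between x and y, strong convexity bounds phi (x + t (y - x)) from above and
    the subgradient at x bounds it from below; divide by t and let t tend
    to 0. *)
Lemma strongly_convex_minorants mu (f : 'rV[R]_n -> \bar R) phi g :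
  strongly_convex mu f -> (forall x, f x = (phi x)%:E) ->
  (forall x y : 'rV[R]_n, phi x + dotp (g x) (y - x) <= phi y) ->
  quadratic_minorants mu phi g.
Proof.
move=> sc fphi sub x y; rewrite -subr_le0.
apply: (@le0_of_le_harmonic _ _ (mu / 2 * dotp (y - x) (y - x))) => k.
move: (@harmonic R k) (@harmonic_gt0 R k) (@harmonic_le1 R k) => t t0 t1.
have t01 : 0 <= t <= 1 by rewrite ltW.
have := sc y x t t01; rewrite !fphi -!EFinB -!EFinM -EFinD lee_fin !enorm_sqr.
have := sub x (t *: y + (1 - t) *: x).
have -> : t *: y + (1 - t) *: x = x + t *: (y - x).
  by apply/rowP => i; rewrite !mxE; ring.
have -> : x + t *: (y - x) - x = t *: (y - x) by rewrite addrC addKr.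
have yE : y = x + (y - x) by rewrite addrC subrK.
rewrite [in dotp y y]yE.
set p := phi (x + _); move: p (phi y) (y - x) => p q d.
rewrite !dotpE (dotpC d x) => H1 H2.
rewrite -(ler_pM2l t0); nra.
Qed.

(** Cocoercivity of the gradient of phi - mu / 2 | . |^2, which is convex and
    (L - mu)-smooth.  With a = g x - g y - mu (x - y) it reads
    | a |^2 <= (L - mu) < a, x - y >. *)
Lemma interpolation mu L phi g x y : mu < L ->
  quadratic_minorants mu phi g -> quadratic_majorants L phi g ->
  0 <= dotp (g x - g y - mu *: (x - y)) (L *: (x - y) - (g x - g y)).
Proof.
move=> muL lo up; have c0 : 0 < L - mu by rewrite subr_gt0.
have half u v : phi u - phi v - dotp (g u) (u - v)
    + mu / 2 * dotp (u - v) (u - v)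
    + 2^-1 / (L - mu) * dotp (g u - g v - mu *: (u - v))
                             (g u - g v - mu *: (u - v)) <= 0.
  (* The minorant at u and the majorant at v are compared at v + s, where the
     gap between the two paraboloids is largest. *)
  set a := g u - g v - mu *: (u - v).
  pose s := (L - mu)^-1 *: a.
  have aE : a = (L - mu) *: s by rewrite scalerA mulfV ?scale1r// gt_eqF.
  have := le_trans (lo u (v + s)) (up v (v + s)).
  have -> : v + s - v = s by rewrite addrC addKr.
  have -> : v + s - u = s - (u - v) by apply/rowP => i; rewrite !mxE; ring.
  have guE : g u = g v + mu *: (u - v) + a.
    by apply/rowP => i; rewrite !mxE; ring.
  rewrite [in dotp (g u) (s - _)]guE [in dotp (g u) (u - v)]guE aE.
  move: (u - v) => d.
  clearbody s; rewrite !dotpE (dotpC s d).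
  have -> : 2^-1 / (L - mu) * ((L - mu) * ((L - mu) * dotp s s))
     = (L - mu) / 2 * dotp s s by field; rewrite gt_eqF.
  nra.
have := lerD (half x y) (half y x).
rewrite -(opprB x y) -(opprB (g x) (g y)).
set b := g x - g y - mu *: (x - y).
have -> : - (g x - g y) - mu *: - (x - y) = - b.
  by apply/rowP => i; rewrite !mxE; ring.
have -> : L *: (x - y) - (g x - g y) = (L - mu) *: (x - y) - b.
  by apply/rowP => i; rewrite !mxE; ring.
have gxE : g x = g y + mu *: (x - y) + b.
  by apply/rowP => i; rewrite !mxE; ring.
rewrite [in dotp (g x) (x - y)]gxE.
clearbody b; move: (x - y) => d; rewrite !dotpE addr0 !opprK.
have : dotp b b = 2 * (L - mu) * (2^-1 / (L - mu) * dotp b b).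
  by field; rewrite gt_eqF.
move: (2^-1 / (L - mu) * dotp b b) => q bE H.
have {}H : 0 <= dotp b d - 2 * q by lra.
by have := mulr_ge0 (ltW c0) H; rewrite bE; lra.
Qed.

(** With s = (L + mu) / 2 and p = mu L, the hypothesis is multiplied by s^2 and
    added to | s a + s^2 u - p e |^2 >= 0, a square chosen so that the products
    <a, u> and <u, e> cancel.  The remaining term in <a, e> is linear in a and vanishes once summed over gradients of
    zero sum. *)
Lemma pointwise_bound mu L (a d e u : 'rV[R]_n) : mu < L ->
  d = e - u -> dotp u u <= 1 ->
  0 <= dotp (a - mu *: d) (L *: d - a) ->
  mu * L * dotp e e <= ((L + mu) / 2) ^+ 2 + (L + mu) * dotp a e.
Proof.
move=> muL -> u1.
pose s := (L + mu) / 2; pose p := mu * L.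
have : 0 <= dotp (s *: a + s ^+ 2 *: u - p *: e) (s *: a + s ^+ 2 *: u - p *: e).
  exact: dotp_ge0.
rewrite !dotpE (dotpC u a) (dotpC e a) (dotpC u e).
move: (dotp a a) (dotp a u) (dotp a e) (dotp e e) (dotp e u) (dotp u u) u1.
move=> aa au ae ee eu uu u1 H1 H2.
have sp : 0 < s ^+ 2 - p by rewrite /s /p; nra.
suff : (s ^+ 2 - p) * (p * ee) <= (s ^+ 2 - p) * (s ^+ 2 * uu + 2 * s * ae).
  rewrite ler_pM2l// => /le_trans; apply.
  have := ler_piMr (sqr_ge0 s) u1; rewrite /s; lra.
have s2 := sqr_ge0 s.
have := mulr_ge0 s2 H2; move: H1; rewrite /s /p.
lra.
Qed.

End SmoothStronglyConvex.

Lemma classM_gradient {R : realType} {n : nat} (mu L : R) (z : 'rV[R]_n)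
    (f : 'rV[R]_n -> \bar R) :
  0 < L -> classM mu L z f ->
  exists phi g, [/\ forall x, f x = (phi x)%:E, quadratic_minorants mu phi g,
    quadratic_majorants L phi g & g z = 0].
Proof.
move=> L0 [[cl pf cf sm sc] mz].
have /choice[g gP] x := subdiff_nonempty x L0 cl pf cf sm mz.
have /choice[phi fphi] x := proper_fin pf (proj1 (gP x)).
have sub x y : phi x + dotp (g x) (y - x) <= phi y.
  by rewrite -lee_fin EFinD -!fphi; exact: (proj2 (gP x)).
have lip x y := smooth_fun_sqr L0 sm (gP x) (gP y).
exists phi, g; split=> //.
- exact: strongly_convex_minorants sc fphi sub.
- exact: descent.
- apply: dotp_eq0; rewrite -(subr0 (g z)).
  have := smooth_fun_sqr L0 sm (gP z) (subdiff_argmin pf mz).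
  by rewrite subrr dotp0l mulr0.
Qed.

(** Each phi i is only known through its paraboloids, so the sum is compared at
    x and at x - t G, G being the sum of the gradients, for small t. *)
Lemma stationary {R : realType} {n m : nat} (L : R) (x : 'rV[R]_n)
    (phi : 'I_m -> 'rV[R]_n -> R) (g : 'I_m -> 'rV[R]_n -> 'rV[R]_n) :
  (forall i, quadratic_majorants L (phi i) (g i)) ->
  (forall y, \sum_i phi i x <= \sum_i phi i y) ->
  \sum_i g i x = 0.
Proof.
move=> up min; set G := \sum_i g i x; apply: dotp_eq0.
apply: (@le0_of_le_harmonic _ _ (m%:R * (L / 2 * dotp G G))) => k.
move: (@harmonic R k) (@harmonic_gt0 R k) => t t0.
have : \sum_i phi i x <= \sum_i (phi i x
     + (dotp (g i x) (- (t *: G)) + L / 2 * dotp (- (t *: G)) (- (t *: G)))).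
  apply: (le_trans (min (x - t *: G))); apply: ler_sum => i _.
  have := up i x (x - t *: G).
  have -> : x - t *: G - x = - (t *: G) by rewrite addrC addKr.
  by rewrite addrA.
rewrite big_split lerDl big_split -dotp_suml -/G sumr_const card_ord /=.
rewrite !dotpE -mulr_natl => H.
rewrite -(ler_pM2l t0); nra.
Qed.

(** * The bound on the minimizer of the sum *)

Theorem theoremV1 (R : realType) (n m : nat) (mu L : R)
    (xbar : 'rV[R]_n) (xs : 'I_m -> 'rV[R]_n)
    (f : 'I_m -> 'rV[R]_n -> \bar R) (xstar : 'rV[R]_n) :
  (0 < m)%N ->
  0 < mu -> mu < L ->
  (forall i : 'I_m, enorm (xs i - xbar) <= 1) ->
  (forall i : 'I_m, classM mu L (xs i) (f i)) ->
  argmin (fun x => (\sum_(i < m) f i x)%E) xstar ->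
  let kappa := L / mu in
  enorm (xstar - xbar) <= 2^-1 * (Num.sqrt kappa + (Num.sqrt kappa)^-1).
Proof.
move=> m0 mu0 muL xs1 fM minf; cbv zeta; set kappa := L / mu.
have L0 : 0 < L by exact: lt_trans muL.
have /choice[phi /choice[g fP]] i := classM_gradient L0 (fM i).
have sumphi y : (\sum_(i < m) f i y)%E = (\sum_i phi i y)%:E.
  by rewrite -sumEFin; apply: eq_bigr => i _; have [-> _ _ _] := fP i.
have G0 : \sum_i g i xstar = 0.
  apply: (@stationary _ _ _ L _ phi) => [i|y]; first by have [] := fP i.
  by rewrite -lee_fin -!sumphi; exact: minf.
set e := xstar - xbar.
have bound i : mu * L * dotp e e
    <= ((L + mu) / 2) ^+ 2 + (L + mu) * dotp (g i xstar) e.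
  have [_ lo up gz] := fP i.
  apply: (@pointwise_bound _ _ _ _ _ (xstar - xs i) _ (xs i - xbar)) => //.
  - by apply/rowP => j; rewrite !mxE; ring.
  - by rewrite -enorm_sqr expr_le1 ?sqrtr_ge0.
  - by have := interpolation xstar (xs i) muL lo up; rewrite gz subr0.
have : \sum_(i < m) mu * L * dotp e e <= \sum_(i < m) (((L + mu) / 2) ^+ 2
    + (L + mu) * dotp (g i xstar) e).
  by apply: ler_sum => i _; exact: bound.
rewrite big_split/=.
have -> : \sum_i (L + mu) * dotp (g i xstar) e = 0.
  by rewrite -mulr_sumr -dotp_suml G0 dotp0l mulr0.
rewrite addr0 !sumr_const card_ord ler_pMn2r// => {}bound.
have k0 : 0 < Num.sqrt kappa by rewrite sqrtr_gt0 divr_gt0.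
have r0 : 0 <= 2^-1 * (Num.sqrt kappa + (Num.sqrt kappa)^-1).
  by rewrite mulr_ge0 ?addr_ge0 ?invr_ge0 ?(ltW k0).
rewrite -(ler_pXn2r (ltn0Sn 1)) ?nnegrE ?sqrtr_ge0// enorm_sqr.
have -> : (2^-1 * (Num.sqrt kappa + (Num.sqrt kappa)^-1)) ^+ 2
    = ((L + mu) / 2) ^+ 2 / (mu * L).
  have kE : Num.sqrt kappa ^+ 2 = kappa by rewrite sqr_sqrtr// divr_ge0 ?ltW.
  have -> : (2^-1 * (Num.sqrt kappa + (Num.sqrt kappa)^-1)) ^+ 2
      = 4^-1 * (Num.sqrt kappa ^+ 2 + 2 + (Num.sqrt kappa ^+ 2)^-1).
    by field; rewrite gt_eqF.
  by rewrite kE /kappa; field; rewrite !gt_eqF.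
by rewrite ler_pdivlMr ?mulr_gt0// mulrC.
Qed.
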